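(* Let $(\Omega,\mathcal F_\infty)$ be a measurable space with a filtration $(\mathcal F_n)_{n\ge1}$ of sub-$\sigma$-fields of $\mathcal F_\infty$, and let $H_0,H_1$ be arbitrary (possibly empty) sets of probability measures on $(\Omega,\mathcal F_\infty)$. Let $\varphi=(\varphi_n)_{n\ge1}$ be a uniformly consistent deterministic binary test for $H_0$ against $H_1$. Fix $\alpha\in(0,1)$ and let $b=(b_k)_{k\ge1}$ be a real sequence with $0<b_k\le\alpha$ for all $k\in\mathbb N$ and $\sum_{k=1}^\infty b_k<\infty$. Then there exist a deterministic binary test $\psi=(\psi_n)_{n\ge1}$ and strictly increasing sample sizes $m_1<m_2<\cdots$ in $\mathbb N$ such that $$\rho(\psi_n=1)\le\alpha\qquad\text{for all }\rho\in H_0,\ n\in\mathbb N,$$ and, for every $i\in\{0,1\}$ with $H_i\neq\varnothing$ and every $K\in\mathbb N$, $$\sup_{\rho\in H_i}\rho\bigl(\exists n\ge m_K:\ \psi_n\ne i\bigr)\le\sum_{k=K}^\infty b_k.$$ Consequently, $\psi$ is uniformly consistent, asymptotically consistent, and asymmetrically consistent at level $\alpha$ (for $H_0$ against $H_1$).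
   Context: $\mathbb N=\{1,2,\ldots\}$. The filtration satisfies $\mathcal F_1\subseteq\mathcal F_2\subseteq\cdots\subseteq\mathcal F_\infty$; it is not required that $\mathcal F_\infty=\sigma(\bigcup_n\mathcal F_n)$. No disjointness of $H_0$ and $H_1$ is assumed. A deterministic binary test is a sequence $\eta=(\eta_n)_{n\ge1}$ of maps $\eta_n:\Omega\to\{0,1\}$ such that $\eta_n$ is $\mathcal F_n$-measurable for each $n$ (with $\{0,1\}$ carrying the discrete $\sigma$-field). For $i\in\{0,1\}$, $\{\eta_n=i\text{ eventually}\}:=\bigcup_{N=1}^\infty\bigcap_{n=N}^\infty\{\eta_n=i\}$. Uniformly consistent (for $H_0$ against $H_1$): for every $\varepsilon>0$ there is $N\in\mathbb N$ such that for every $n\ge N$, every $i\in\{0,1\}$ and every $\rho\in H_i$, $\rho(\eta_n\ne i)<\varepsilon$. Asymmetrically consistent at level $\alpha\in(0,1)$: $\rho(\eta_n=1)\le\alpha$ for all $\rho\in H_0$ and all $n\in\mathbb N$, and $\rho(\eta_n=1\text{ eventually})=1$ for all $\rho\in H_1$. Asymptotically consistent: $\rho(\eta_n=i\text{ eventually})=1$ for every $i\in\{0,1\}$ and every $\rho\in H_i$. *)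

(* Defs.v *)
From mathcomp Require Import all_boot all_order all_algebra.
From mathcomp Require Import all_classical all_reals all_analysis.

Set Implicit Arguments.
Unset Strict Implicit.
Unset Printing Implicit Defensive.

Import Order.TTheory GRing.Theory Num.Theory.

Local Open Scope classical_set_scope.
Local Open Scope ring_scope.

(* Times range over {1, 2, ...}: sequences are functions on nat whose value at
   0 is irrelevant.  The value set {0,1} of a test is bool (0 = false,
   1 = true) with its discrete sigma-algebra. *)

(* F_infinity is the sigma-algebra of the measurable space Omega itself. *)
Definition is_filtration (d : measure_display) (Omega : measurableType d)
    (F : nat -> set (set Omega)) : Prop :=
  [/\ forall n, (1 <= n)%N -> sigma_algebra setT (F n),
      forall n, (1 <= n)%N -> F n `<=` measurable &
      forall n p, (1 <= n)%N -> (n <= p)%N -> F n `<=` F p].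

(* When F n is a sigma-algebra, the measurable sets of g_sigma_algebraType (F n)
   are exactly the elements of F n (measurable_g_measurableTypeE). *)
Definition is_test (d : measure_display) (Omega : measurableType d)
    (F : nat -> set (set Omega)) (eta : nat -> Omega -> bool) : Prop :=
  forall n, (1 <= n)%N ->
    measurable_fun [set: g_sigma_algebraType (F n)]
      (eta n : g_sigma_algebraType (F n) -> bool).

Definition hyp (d : measure_display) (Omega : measurableType d) (R : realType)
    (H0 H1 : set (probability Omega R)) (i : bool) : set (probability Omega R) :=
  if i then H1 else H0.

Definition eventually_eq (Omega : Type) (eta : nat -> Omega -> bool) (i : bool) :
    set Omega :=
  \bigcup_(N >= 1) \bigcap_(n >= N) [set x | eta n x = i].

Definition uniformly_consistent (d : measure_display)
    (Omega : measurableType d) (R : realType)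
    (H0 H1 : set (probability Omega R)) (eta : nat -> Omega -> bool) : Prop :=
  forall eps : R, 0 < eps ->
    exists2 N : nat, (1 <= N)%N &
      forall n, (N <= n)%N -> forall (i : bool) (rho : probability Omega R),
        hyp H0 H1 i rho -> (rho [set x | eta n x != i] < eps%:E)%E.

Definition asymmetrically_consistent (d : measure_display)
    (Omega : measurableType d) (R : realType)
    (H0 H1 : set (probability Omega R)) (alpha : R)
    (eta : nat -> Omega -> bool) : Prop :=
  (forall rho : probability Omega R, H0 rho ->
     forall n, (1 <= n)%N -> (rho [set x | eta n x = true] <= alpha%:E)%E) /\
  (forall rho : probability Omega R, H1 rho ->
     rho (eventually_eq eta true) = 1%E).

Definition asymptotically_consistent (d : measure_display)
    (Omega : measurableType d) (R : realType)
    (H0 H1 : set (probability Omega R)) (eta : nat -> Omega -> bool) : Prop :=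
  forall (i : bool) (rho : probability Omega R),
    hyp H0 H1 i rho -> rho (eventually_eq eta i) = 1%E.

(* Main.v *)
Require Import Defs.
From mathcomp Require Import all_boot all_order all_algebra.
From mathcomp Require Import all_classical all_reals all_analysis.

Set Implicit Arguments.
Unset Strict Implicit.
Unset Printing Implicit Defensive.

Import Order.TTheory GRing.Theory Num.Theory.

Local Open Scope classical_set_scope.
Local Open Scope ring_scope.

(** The test [psi] is [phi] slowed down.  Uniform consistency provides sample
    sizes [m 1 < m 2 < ...] such that the decision [phi (m k)] errs with
    probability at most [b k], uniformly over both hypotheses.  Let [psi] repeat
    the decision [phi (m k)] throughout the block [m k <= n < m k.+1], and accept
    the null hypothesis before [m 1].  Three things follow.

    - No information from the future is used, since [m k <= n] in the block, so
      [psi] is adapted to the filtration ([is_test_subsample]).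
    - At each time [psi] either accepts the null hypothesis outright or repeats
      one single decision [phi (m k)], so its level is at most
      [b k <= alpha].
    - From time [m K] onwards [psi] only takes the countably many decisions
      [phi (m k)], [k >= K], each repeated over a whole block.  Hence [psi] errs
      at some time after [m K] only if one of these does, and the union bound
      gives the tail sum of [b] from [K] ([late_errors_subsample]).

    As the series converges, these tails vanish: the probability of making any
    error after a given time is uniformly small.  This strengthens uniform
    consistency, and it also yields almost sure eventual correctness, because
    the event that errors never stop lies in every late-error event
    ([uniformly_consistent_late], [asymptotically_consistent_late]).  *)

(** * Blocks of sample sizes *)

(** For increasing [m] with [m 0 = 0], this is the index [k] of the block
    [m k <= n < m k.+1] containing [n]; restricting the maximum to [k <= n]
    loses nothing because such an [m] dominates the identity. *)
Definition stage (m : nat -> nat) (n : nat) : nat :=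
  \max_(k < n.+1 | (m k <= n)%N) k.

Lemma stage_le (m : nat -> nat) (n : nat) : m 0 = 0 -> (m (stage m n) <= n)%N.
Proof.
move=> m0; rewrite /stage; elim/big_ind: _ => [|j k mj mk|//].
  by rewrite m0.
by rewrite /maxn; case: ifP.
Qed.

Lemma stage_ge (m : nat -> nat) (n K : nat) :
  (forall k, (k <= m k)%N) -> (m K <= n)%N -> (K <= stage m n)%N.
Proof.
move=> km mKn.
have Kn : (K < n.+1)%N by rewrite ltnS (leq_trans (km K)).
exact: (@leq_bigmax_cond _ _ (fun k : 'I_n.+1 => k : nat) (Ordinal Kn)).
Qed.

(** The recursion forces both strict growth and [N k.+1 <= m k.+1]; starting it
    at [0] makes block [0] the initial period before the first sample size. *)
Fixpoint spread (N : nat -> nat) (k : nat) : nat :=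
  if k is k'.+1 then (maxn (spread N k') (N k)).+1 else 0.

Lemma spread_ltS (N : nat -> nat) (k : nat) : (spread N k < spread N k.+1)%N.
Proof. by rewrite /= ltnS leq_maxl. Qed.

Lemma spread_ge (N : nat -> nat) (k : nat) :
  (0 < k)%N -> (N k <= spread N k)%N.
Proof. by case: k => // k _; rewrite /= leqW // leq_maxr. Qed.

Lemma spread_ge_id (N : nat -> nat) (k : nat) : (k <= spread N k)%N.
Proof. by elim: k => // k IH; exact: leq_ltn_trans IH (spread_ltS N k). Qed.

(** * Slowed-down tests *)

Definition subsample (Omega : Type) (m : nat -> nat) (eta : nat -> Omega -> bool)
    (n : nat) (x : Omega) : bool :=
  (0 < stage m n)%N && eta (m (stage m n)) x.

Definition late_errors (Omega : Type) (eta : nat -> Omega -> bool) (i : bool)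
    (N : nat) : set Omega :=
  [set x | exists2 n, (N <= n)%N & eta n x != i].

Section tests.
Context (d : measure_display) (Omega : measurableType d).
Variable F : nat -> set (set Omega).
Hypothesis filtF : is_filtration F.

Lemma is_test_subsample (m : nat -> nat) (eta : nat -> Omega -> bool) :
  m 0 = 0 -> (forall k, (k <= m k)%N) ->
  is_test F eta -> is_test F (subsample m eta).
Proof.
move=> m0 km teta n n1; rewrite /subsample.
case: (posnP (stage m n)) => [->|k0]; first exact: measurable_cst.
case: filtF => sF _ incF.
set p := m (stage m n).
have p1 : (1 <= p)%N by exact: leq_trans k0 (km _).
have pn : (p <= n)%N by exact: stage_le.
move=> _ Y mY; have := teta p p1 measurableT Y mY.
rewrite !setTI !measurable_g_measurableTypeE; [|exact: sF..].
exact: incF.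
Qed.

Lemma measurable_error (eta : nat -> Omega -> bool) (i : bool) (n : nat) :
  is_test F eta -> (1 <= n)%N -> measurable [set x | eta n x != i].
Proof.
move=> teta n1; case: filtF => sF mF _; apply: (mF n n1).
have /= := teta n n1 measurableT [set b | b != i] I.
by rewrite setTI measurable_g_measurableTypeE //; exact: sF.
Qed.

Lemma measurable_late_errors (eta : nat -> Omega -> bool) (i : bool) (N : nat) :
  is_test F eta -> (1 <= N)%N -> measurable (late_errors eta i N).
Proof.
move=> teta N1.
have -> : late_errors eta i N =
    \bigcup_(n in [set n | (N <= n)%N]) [set x | eta n x != i] by [].
apply: bigcup_measurable => n /= Nn; apply: measurable_error => //.
exact: leq_trans Nn.
Qed.

(** A decision is merely repeated inside a block, so the late-error event is
    covered by one error event per block, and the bound sums over blocks instead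
    of over times. *)
Lemma late_errors_subsample (R : realType) (rho : probability Omega R)
    (m : nat -> nat) (eta : nat -> Omega -> bool) (i : bool) (b : nat -> R)
    (K : nat) :
  is_test F eta -> m 0 = 0 -> (forall k, (k <= m k)%N) -> (1 <= K)%N ->
  (forall k, (1 <= k)%N -> (rho [set x | eta (m k) x != i] <= (b k)%:E)%E) ->
  (rho (late_errors (subsample m eta) i (m K)) <= \sum_(K <= k <oo) (b k)%:E)%E.
Proof.
move=> teta m0 km K1 errb.
(* time 0 carries no measurability information on [eta], hence the cut-off *)
pose E k := if (1 <= k)%N then [set x | eta (m k) x != i] else set0.
have mE k : measurable (E k).
  rewrite /E; case: ifP => // k1.
  by apply: measurable_error => //; exact: leq_trans (km k).
apply: (@le_trans _ _ (\sum_(K <= k <oo) rho (E k))%E).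
  apply: measure_sigma_subadditive_tail => //.
    apply: measurable_late_errors; first exact: is_test_subsample.
    exact: leq_trans (km K).
  move=> x [n mKn]; have Kk := stage_ge km mKn.
  have k1 := leq_trans K1 Kk.
  rewrite /subsample k1 /= => errx; exists (stage m n).
    by apply/negP; rewrite -leqNgt.
  by rewrite /E k1.
rewrite (eseries_cond (fun k => rho (E k))) (eseries_cond (fun k => (b k)%:E)).
rewrite !eseries_mkcondr.
apply: lee_nneseries => k; first by case: ifP.
by move=> _; case: ifP => // Kk; rewrite /E (leq_trans K1 Kk) errb // (leq_trans K1 Kk).
Qed.

End tests.

(** * Consistency from small late-error probabilities *)

Section consistency.
Context (d : measure_display) (Omega : measurableType d) (R : realType).
Variables (F : nat -> set (set Omega)) (H0 H1 : set (probability Omega R)).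
Variable eta : nat -> Omega -> bool.
Hypotheses (filtF : is_filtration F) (teta : is_test F eta).
Hypothesis late_small : forall eps : R, 0 < eps -> exists2 N, (1 <= N)%N &
  forall (i : bool) (rho : probability Omega R), hyp H0 H1 i rho ->
    (rho (late_errors eta i N) < eps%:E)%E.

(** An error at a time [n >= N] is in particular a late error from [N]. *)
Lemma uniformly_consistent_late : uniformly_consistent H0 H1 eta.
Proof.
move=> eps /late_small[N N1 small]; exists N => // n Nn i rho /small.
apply: le_lt_trans; apply: le_measure; rewrite ?inE.
- by apply: measurable_error teta _ => //; exact: leq_trans Nn.
- exact: measurable_late_errors teta _.
- by move=> x errx; exists n.
Qed.

(** A path on which [eta] is not eventually [i] makes errors after every time,
    so this exceptional set has probability below every [eps]. *)
Lemma asymptotically_consistent_late : asymptotically_consistent H0 H1 eta.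
Proof.
move=> i rho Hrho.
have mEv : measurable (eventually_eq eta i).
  apply: bigcup_measurable => N /= N1; apply: bigcap_measurable.
    by exists N => /=.
  move=> n /= Nn.
  have -> : [set x | eta n x = i] = ~` [set x | eta n x != i].
    by apply/seteqP; split => x /=; case: eqP.
  apply: measurableC; apply: (measurable_error filtF) => //.
  exact: leq_trans Nn.
have rhoC : rho (~` eventually_eq eta i) = 0%E.
  apply/eqP; rewrite eq_le measure_ge0 andbT; apply/lee_addgt0Pr => eps eps0.
  have [N N1 small] := late_small eps0.
  rewrite add0e; apply: (le_trans _ (ltW (small i rho Hrho))).
  apply: le_measure; rewrite ?inE.
  - exact: measurableC.
  - exact: measurable_late_errors teta _.
  - move=> x notEv; apply: contrapT => noerr; apply: notEv.
    exists N => // n /= Nn; apply: contrapT => /eqP errn.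
    by apply: noerr; exists n.
by rewrite -[eventually_eq _ _]setCK probability_setC ?rhoC ?sube0//; exact: measurableC.
Qed.

End consistency.

(** The value [b 0] is unconstrained, so the general convergence of tails is
    applied to the series filtered by [1 <= k], which has the same tails from
    every [K >= 1]. *)
Lemma nneseries_tail_lt (R : realType) (b : nat -> R) (eps : R) :
  (forall k, (1 <= k)%N -> 0 <= b k) -> (\sum_(1 <= k <oo) (b k)%:E < +oo)%E ->
  0 < eps -> exists2 K, (1 <= K)%N & (\sum_(K <= k <oo) (b k)%:E < eps%:E)%E.
Proof.
move=> b0 sumb eps0.
have tails0 : (\sum_(K <= k <oo | (1 <= k)%N) (b k)%:E @[K --> \oo] --> 0)%E.
  apply: nneseries_tail_cvg => [|k /b0]; last by rewrite lee_fin.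
  by rewrite (eseries_cond (fun k => (b k)%:E)) in sumb.
have {tails0} /fine_cvgP[finT /cvgr_lt/(_ _ eps0) ltT] := tails0.
have [K0 _ HK0] : \forall K \near \oo,
    (\sum_(K <= k <oo | (1 <= k)%N) (b k)%:E < eps%:E)%E.
  by near=> K; rewrite -[ltLHS]fineK ?lte_fin; near: K.
exists K0.+1 => //; have := HK0 K0.+1 (leqnSn K0).
rewrite (eseries_cond (fun k => (b k)%:E)).
rewrite (eseries_cond (fun k => (b k)%:E) xpredT).
congr (_ < _)%E; apply/congr_lim/funext => n; apply: eq_bigl => k /=.
by rewrite andb_idl // => /(leq_ltn_trans _) ->.
Unshelve. all: by end_near.
Qed.

(** * The slowed-down test for a summable error budget *)

Theorem theorem3p1 (d : measure_display) (Omega : measurableType d)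
    (R : realType) (F : nat -> set (set Omega))
    (H0 H1 : set (probability Omega R)) (phi : nat -> Omega -> bool)
    (alpha : R) (b : nat -> R) :
  is_filtration F ->
  is_test F phi ->
  uniformly_consistent H0 H1 phi ->
  0 < alpha < 1 ->
  (forall k, (1 <= k)%N -> 0 < b k <= alpha) ->
  (\sum_(1 <= k <oo) (b k)%:E < +oo)%E ->
  exists (psi : nat -> Omega -> bool) (m : nat -> nat),
    is_test F psi /\
    (1 <= m 1)%N /\
    (forall k, (1 <= k)%N -> (m k < m k.+1)%N) /\
    (forall rho : probability Omega R, H0 rho ->
       forall n, (1 <= n)%N -> (rho [set x | psi n x = true] <= alpha%:E)%E) /\
    (forall i : bool, hyp H0 H1 i !=set0 ->
       forall K : nat, (1 <= K)%N ->
         (ereal_sup [set (rho : probability Omega R)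
                           [set x | exists2 n, (m K <= n)%N & psi n x != i]
                    | rho in hyp H0 H1 i]
          <= \sum_(K <= k <oo) (b k)%:E)%E) /\
    uniformly_consistent H0 H1 psi /\
    asymptotically_consistent H0 H1 psi /\
    asymmetrically_consistent H0 H1 alpha psi.
Proof.
move=> filtF tphi ucphi /andP[alpha0 _] b_bounds sumb.
have ex_size k : exists N, (1 <= k)%N ->
    forall n, (N <= n)%N -> forall i (rho : probability Omega R),
    hyp H0 H1 i rho -> (rho [set x | phi n x != i] <= (b k)%:E)%E.
  case: (posnP k) => [->|k1]; first by exists 0.
  have /andP[bk0 _] := b_bounds k k1.
  have [N _ HN] := ucphi _ bk0.
  by exists N => _ n Nn i rho Hrho; apply/ltW/HN.
have [N HN] := choice ex_size.
pose m := spread N; pose psi := subsample m phi.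
have m0 : m 0 = 0 by [].
have km : forall k, (k <= m k)%N by exact: spread_ge_id.
have err_m k i (rho : probability Omega R) : (1 <= k)%N -> hyp H0 H1 i rho ->
    (rho [set x | phi (m k) x != i] <= (b k)%:E)%E.
  by move=> k1; apply: HN => //; exact: spread_ge.
have tpsi : is_test F psi by exact: is_test_subsample.
have late K i (rho : probability Omega R) : (1 <= K)%N -> hyp H0 H1 i rho ->
    (rho (late_errors psi i (m K)) <= \sum_(K <= k <oo) (b k)%:E)%E.
  move=> K1 Hrho; apply: (late_errors_subsample filtF) => // k k1.
  exact: err_m.
have level (rho : probability Omega R) : H0 rho -> forall n, (1 <= n)%N ->
    (rho [set x | psi n x = true] <= alpha%:E)%E.
  move=> Hrho n _; rewrite /psi /subsample.
  case: (posnP (stage m n)) => [_|k1] /=.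
    (* before [m 1] the null hypothesis is accepted: no false rejection at all *)
    have -> : [set x : Omega | false = true] = set0 by apply/seteqP; split.
    by rewrite measure0 lee_fin ltW.
  have /andP[_ ba] := b_bounds _ k1.
  have -> : [set x | phi (m (stage m n)) x = true] =
            [set x | phi (m (stage m n)) x != false].
    by apply/seteqP; split => x /=; case: (phi _ x).
  by apply: (@le_trans _ _ (b (stage m n))%:E); [exact: err_m|rewrite lee_fin].
have late_small eps : 0 < eps -> exists2 n, (1 <= n)%N &
    forall i (rho : probability Omega R), hyp H0 H1 i rho ->
      (rho (late_errors psi i n) < eps%:E)%E.
  move=> eps0.
  have b_ge0 k : (1 <= k)%N -> 0 <= b k by move=> /b_bounds/andP[/ltW].
  have [K K1 tailK] := nneseries_tail_lt b_ge0 sumb eps0.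
  exists (m K) => [|i rho Hrho]; first exact: leq_trans (km K).
  exact: le_lt_trans (late K i rho K1 Hrho) tailK.
have asym := asymptotically_consistent_late filtF tpsi late_small.
exists psi, m; split => //; split; first exact: km.
split; first by move=> k _; exact: spread_ltS.
split => //; split.
  by move=> i _ K K1; apply: ge_ereal_sup => _ [rho Hrho <-]; exact: late.
split; first exact: uniformly_consistent_late filtF tpsi late_small.
by split => //; split => // rho; exact: (asym true rho).
Qed.
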